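(* Let $n\ge 2$ and let $K$ be a field with $\mathrm{char}(K)=0$ or $\mathrm{char}(K)>n$, with algebraic closure $\overline{K}$. Then the dimension of the algebraic variety $$U_n=\{(A,B)\in M_n(\overline{K})^2 \;|\; B\text{ is nilpotent and } A^2-2AB+B^2=0\}$$ is $n^2-1$.
   Context: $U_n$ is regarded as a (possibly reducible) closed affine algebraic set in $M_n(\overline{K})^2\cong\overline{K}^{2n^2}$; its dimension is the maximum of the dimensions of its irreducible components. *)

(* Defs.v *)
From mathcomp Require Export all_boot all_order all_algebra.
From mathcomp Require Export classical_sets.
From mathcomp Require Export mpoly.

Set Implicit Arguments.
Unset Strict Implicit.
Unset Printing Implicit Defensive.

Import GRing.Theory.

Local Open Scope classical_set_scope.
Local Open Scope ring_scope.

Section AffineAlgebraicSets.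
Variables (F : fieldType) (m : nat).
Implicit Types X Z : set 'rV[F]_m.

Definition zero_locus (S : set {mpoly F[m]}) : set 'rV[F]_m :=
  [set v | forall p, S p -> p.@[v 0] = 0].

Definition zariski_closed Z : Prop := exists S, Z = zero_locus S.

Definition irreducible_closed Z : Prop :=
  [/\ zariski_closed Z, Z !=set0 &
      forall Z1 Z2, zariski_closed Z1 -> zariski_closed Z2 ->
        Z = Z1 `|` Z2 -> Z = Z1 \/ Z = Z2].

Definition irreducible_component X Z : Prop :=
  [/\ irreducible_closed Z, Z `<=` X &
      forall Z', irreducible_closed Z' -> Z' `<=` X -> Z `<=` Z' -> Z' = Z].

(* C 0 `<` C 1 `<` ... `<` C d; the values of C beyond d are irrelevant. *)
Definition irreducible_chain X (d : nat) (C : nat -> set 'rV[F]_m) : Prop :=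
  [/\ forall i, (i <= d)%N -> irreducible_closed (C i),
      forall i, (i < d)%N -> C i `<` C i.+1 &
      C d `<=` X].

(* The supremum d of the lengths of the chains is attained. *)
Definition krull_dim X (d : nat) : Prop :=
  (exists C, irreducible_chain X d C) /\
  (forall e C, irreducible_chain X e C -> (e <= d)%N).

(* For a closed set X: the components all have a finite dimension, and the
   largest of these dimensions is d. *)
Definition algebraic_set_dim X (d : nat) : Prop :=
  (exists2 Z, irreducible_component X Z & krull_dim Z d) /\
  (forall Z, irreducible_component X Z ->
     exists2 e, krull_dim Z e & (e <= d)%N).

End AffineAlgebraicSets.

Definition is_algebraic_closure (K : fieldType) (L : closedFieldType)
    (iota : {rmorphism K -> L}) : Prop :=
  forall z : L, algebraicOver iota z.

Definition nilpotent_mx (R : nzRingType) (n : nat) (B : 'M[R]_n) : Prop :=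
  exists k : nat, B ^+ k = 0.

(* The identification of M_n(F)^2 with the affine space of dimension 2 n^2. *)
Definition mx_pair_coords (F : fieldType) (n : nat) (AB : 'M[F]_n * 'M[F]_n) :
    'rV[F]_(n * n + n * n) :=
  row_mx (mxvec AB.1) (mxvec AB.2).

Definition U (F : fieldType) (n : nat) : set ('M[F]_n * 'M[F]_n) :=
  [set AB | nilpotent_mx AB.2 /\
            AB.1 ^+ 2 - (AB.1 * AB.2) *+ 2 + AB.2 ^+ 2 = 0].

(* Main.v *)
Require Import Defs.
From mathcomp Require Import boolp.

Set Implicit Arguments.
Unset Strict Implicit.
Unset Printing Implicit Defensive.

Import GRing.Theory.

Local Open Scope classical_set_scope.
Local Open Scope ring_scope.

(** Put [X = A - B].  The equation becomes [XB - BX = X^2], and it forces [X] to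
    be nilpotent: on the stable range of [X] it exhibits the identity as a
    commutator, and a trace argument makes this range zero
    ([commutator_square_nilpotent]).  Hence [X] lies in one of finitely many
    conjugacy classes, those of 0/1 matrices ([nilpotent_normal_form]).  Let [J]
    be such a matrix, with a centralizer of dimension [r].  The class of [J] has
    dimension [n^2 - r].  For a given [X] in it the solutions [B] form a
    translate of the centralizer of [X], on which [tr B = 0] is a nontrivial
    condition because the identity has trace [n != 0].  Every class therefore
    contributes at most [(n^2 - r) + (r - 1) = n^2 - 1].  When [J] is a single
    Jordan block the centralizer consists of the polynomials in [J], all the
    solutions of trace zero are nilpotent, and the bound is attained.

    Chains of irreducible closed sets are related to parameter counts by
    algebraic independence.  A chain of length [e] produces [e] functions which
    are independent on its largest set ([irreducible_chain_independent]), while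
    more than [d] regular functions of [d] parameters are always dependent
    ([regular_dependent]).  To apply this to a class, the group of matrices [g]
    in [X = g^-1 J g] is replaced by an affine slice transverse to the
    centralizer ([generic_slice], [class_dependent]); the relations obtained for
    the finitely many classes are multiplied together ([U_dependent]).

    Conversely, the pairs attached to a single Jordan block contain a family
    with [n^2 - 1] parameters, each of which is up to a nonzero factor a
    polynomial in the pair ([family_coordinateE]).  The closures of the images of
    the coordinate subspaces are irreducible because any two parameters are
    joined by a line, and they form a strict chain ([family_chain]). *)

(** * Closed sets, irreducibility and algebraic independence *)

Section ZariskiTopology.
Variables (F : fieldType) (m : nat).
Implicit Types (Y Z : set 'rV[F]_m) (p q : {mpoly F[m]}).

Definition vanishing_ideal Y : set {mpoly F[m]} :=
  [set p | forall v, Y v -> p.@[v 0] = 0].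

Definition zariski_closure Y := zero_locus (vanishing_ideal Y).

Lemma zariski_closure_closed Y : zariski_closed (zariski_closure Y).
Proof. by exists (vanishing_ideal Y). Qed.

Lemma sub_zariski_closure Y : Y `<=` zariski_closure Y.
Proof. by move=> v Yv p; apply. Qed.

Lemma zariski_closure_min Y Z :
  zariski_closed Z -> Y `<=` Z -> zariski_closure Y `<=` Z.
Proof.
by move=> [S ->] YS v Yv p Sp; apply: Yv => w /YS; apply.
Qed.

Lemma closed_inter_zeros Z p :
  zariski_closed Z -> zariski_closed (Z `&` [set v | p.@[v 0] = 0]).
Proof.
move=> [S ->]; exists (S `|` [set p]); apply/seteqP; split=> v.
  by move=> [Sv pv] q [/Sv | ->].
move=> Sv; split; last by apply: Sv; right.
by move=> q Sq; apply: Sv; left.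
Qed.

Lemma irreducible_prime Z p q :
    irreducible_closed Z ->
    (forall v, Z v -> p.@[v 0] * q.@[v 0] = 0) ->
  vanishing_ideal Z p \/ vanishing_ideal Z q.
Proof.
move=> [clZ _ irrZ] pq0.
have [|Zp|Zq] := irrZ _ _ (closed_inter_zeros p clZ) (closed_inter_zeros q clZ).
- apply/seteqP; split=> [v Zv|v [] []] //.
  by move/eqP: (pq0 v Zv); rewrite mulf_eq0 => /orP[] /eqP; [left | right].
- by left=> v; rewrite Zp => -[].
- by right=> v; rewrite Zq => -[].
Qed.

Lemma irreducible_zariski_closure Y :
    Y !=set0 ->
    (forall p q, (forall v, Y v -> p.@[v 0] * q.@[v 0] = 0) ->
       vanishing_ideal Y p \/ vanishing_ideal Y q) ->
  irreducible_closed (zariski_closure Y).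
Proof.
move=> [v0 Yv0] primeY; split; first exact: zariski_closure_closed.
  by exists v0; apply: sub_zariski_closure.
move=> Z1 Z2 clZ1 clZ2 defZ.
have subZ Z' : zariski_closed Z' -> Z' `<=` zariski_closure Y ->
    zariski_closure Y = Z' \/ exists p, ~ vanishing_ideal Y p
      /\ forall v, Z' v -> p.@[v 0] = 0.
  move=> clZ' sZ'Y; have [YZ' | ] := pselect (Y `<=` Z').
    by left; apply/seteqP; split=> //; apply: zariski_closure_min.
  move/existsNP=> [v /not_implyP[Yv nZ'v]]; right; case: clZ' nZ'v => S -> nSv.
  have [p /not_implyP[Sp pv]] : exists p, ~ (S p -> p.@[v 0] = 0).
    exact/existsNP.
  by exists p; split=> [/(_ v Yv)|w]; [apply: pv | apply].
have [| |[p1 [nYp1 Z1p1]]] := subZ Z1 clZ1; [by rewrite defZ => v; left|by left|].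
have [| |[p2 [nYp2 Z2p2]]] := subZ Z2 clZ2; [by rewrite defZ => v; right|by right|].
have [v Yv| // | //] := primeY p1 p2.
have : zariski_closure Y v by apply: sub_zariski_closure.
by rewrite defZ => -[/Z1p1->|/Z2p2->]; rewrite ?mul0r ?mulr0.
Qed.

Lemma closed_proper_separation Y Z :
    zariski_closed Y -> Y `<` Z ->
  exists2 p, vanishing_ideal Y p & ~ vanishing_ideal Z p.
Proof.
move=> [S ->] [_ /existsNP[v /not_implyP[Zv /existsNP[p /not_implyP[Sp pv]]]]].
by exists p => [w|/(_ v Zv)//]; apply.
Qed.

Definition alg_independent_on Z k (f : 'I_k -> {mpoly F[m]}) : Prop :=
  forall P : {mpoly F[k]},
    (forall v, Z v -> P.@[fun i => (f i).@[v 0]] = 0) -> P = 0.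

End ZariskiTopology.

Lemma meval_mmap (F : fieldType) (k m : nat) (f : 'I_k -> {mpoly F[m]})
    (P : {mpoly F[k]}) (v : 'I_m -> F) :
  (mmap (@mpolyC m F) f P).@[v] = P.@[fun i => (f i).@[v]].
Proof.
rewrite [RHS]/meval /mmap rmorph_sum /=; apply: eq_bigr => a _.
rewrite mevalM mevalC rmorph_prod /=; congr (_ * _).
by apply: eq_bigr => i _; rewrite rmorphXn.
Qed.

Lemma meval_mwiden (F : fieldType) (k : nat) (P : {mpoly F[k]})
    (v : 'I_k.+1 -> F) :
  (mwiden P).@[v] = P.@[fun i => v (widen_ord (leqnSn k) i)].
Proof.
by rewrite meval_mmap; apply: meval_eq => i; rewrite mevalXU.
Qed.

Lemma mpoly_last_variable (F : fieldType) (k : nat) (P : {mpoly F[k.+1]}) :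
  exists q : {poly {mpoly F[k]}}, P = (map_poly (@mwiden k F) q).['X_ord_max].
Proof.
elim/mpolyind: P => [|c a P _ _ [q ->]].
  by exists 0; rewrite rmorph0 horner0.
exists ((c%:MP * \prod_(i < k) 'X_i ^+ a (widen_ord (leqnSn k) i))%:P
        * 'X^(a ord_max) + q).
rewrite rmorphD /= hornerD; congr (_ + _).
rewrite rmorphM /= map_polyC map_polyXn /= hornerCM hornerXn.
rewrite mwidenM mwidenC -mul_mpolyC -mulrA; congr (_ * _).
rewrite mpolyXE_id big_ord_recr /=; congr (_ * _).
rewrite rmorph_prod /=; apply: eq_bigr => i _.
by rewrite rmorphXn /= mwidenX mnmwiden1.
Qed.

(** A function vanishing on the smaller set but not on the larger one is
    transcendental over functions that stay independent on the smaller set: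
    in a relation [c + g q = 0] on [Z1] the constant term [c] dies already on
    [Z0], and [g] can then be cancelled on the irreducible [Z1]. *)
Lemma alg_independent_extend (F : fieldType) (m k : nat) (Z0 Z1 : set 'rV[F]_m)
    (f : 'I_k -> {mpoly F[m]}) :
    irreducible_closed Z0 -> irreducible_closed Z1 -> Z0 `<` Z1 ->
    alg_independent_on Z0 f ->
  exists f' : 'I_k.+1 -> {mpoly F[m]}, alg_independent_on Z1 f'.
Proof.
move=> irrZ0 irrZ1 ltZ indf.
have [clZ0 _ _] := irrZ0; have [g g0 g1] := closed_proper_separation clZ0 ltZ.
pose h v := meval (fun i => (f i).@[(v : 'rV_m) 0]).
exists (fun i => oapp f g (unlift ord_max i)) => P P0.
have [q defP] := mpoly_last_variable P.
suff q0 : q = 0 by rewrite defP q0 rmorph0 horner0.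
have {P0 defP} : forall v, Z1 v -> (map_poly (h v) q).[g.@[v 0]] = 0.
  move=> v /P0; rewrite {}defP; set w := fun i => _.
  have -> : g.@[v 0] = ('X_ord_max).@[w] by rewrite mevalXU /w unlift_none.
  rewrite -horner_map /= -map_poly_comp /= => <-.
  congr (_.[_]); apply: eq_map_poly => p /=.
  rewrite meval_mwiden; apply: meval_eq => i; rewrite /w.
  have -> : widen_ord (leqnSn k) i = lift ord_max i.
    by apply: ord_inj; rewrite lift_max.
  by rewrite liftK.
elim/poly_ind: q => // q c IH qc0.
have c0 : c = 0.
  apply: indf => v Z0v; have := qc0 v (ltZ.1 v Z0v).
  rewrite rmorphD rmorphM /= map_polyX map_polyC /= hornerMXaddC.
  by rewrite (g0 v Z0v) mulr0 add0r.
rewrite {}c0 in qc0 *; suff -> : q = 0 by rewrite mul0r addr0.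
apply: IH => v Z1v.
pose Q := (map_poly (mmap (@mpolyC m F) f) q).[g].
have QE u : (map_poly (h u) q).[g.@[u 0]] = Q.@[u 0].
  rewrite /Q -horner_map /= -map_poly_comp; congr (_.[_]).
  by apply: eq_map_poly => p /=; rewrite meval_mmap.
rewrite QE; have [|/(_ v Z1v)//|//] := irreducible_prime (p := Q) (q := g) irrZ1.
move=> u /qc0; rewrite rmorphD rmorphM /= map_polyX map_polyC /= hornerMXaddC.
by rewrite meval0 addr0 QE.
Qed.

Lemma irreducible_chain_independent (F : fieldType) (m : nat)
    (X : set 'rV[F]_m) (e : nat) (C : nat -> set 'rV[F]_m) (i : nat) :
    irreducible_chain X e C -> (i <= e)%N ->
  exists f : 'I_i -> {mpoly F[m]}, alg_independent_on (C i) f.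
Proof.
move=> [irrC ltC _]; elim: i => [|i IH] ie.
  exists (fun=> 0) => P P0; have [_ [v C0v] _] := irrC 0%N ie.
  apply/mpolyP => a; have := P0 v C0v.
  have a0 (b : 'X_{1..0}) : b = 0%MM by apply/mnmP => -[].
  have /msize1_polyC-> : (msize P <= 1)%N.
    rewrite msizeE; apply/bigmax_leqP_seq => b _ _.
    by rewrite (a0 b) mdeg0.
  by rewrite mevalC => ->; rewrite mpolyC0.
have [f indf] := IH (ltnW ie).
apply: alg_independent_extend indf; last exact: ltC.
  exact/irrC/ltnW.
exact: irrC.
Qed.

(** * Regular functions on a principal open set, and counting parameters *)

Section RegularFunctions.
Variables (F : fieldType) (R : comNzRingType) (T : Type).
Variables (ev : T -> {rmorphism R -> F}) (cst : F -> R).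
Hypothesis evC : forall t c, ev t (cst c) = c.
Variable delta : R.
Implicit Types (f g : T -> F).

(** The functions [p / delta ^+ N], with [p] in the ring [R] of functions
    on [T]; the values where [delta] vanishes are ignored. *)
Definition regular f : Prop :=
  exists N p, forall t, ev t delta != 0 -> f t * ev t delta ^+ N = ev t p.

Lemma regular_ev p : regular (fun t => ev t p).
Proof. by exists 0%N, p => t _; rewrite mulr1. Qed.

Lemma regular_cst c : regular (fun=> c).
Proof. by exists 0%N, (cst c) => t _; rewrite mulr1 evC. Qed.

Lemma eq_regular f g :
  (forall t, ev t delta != 0 -> f t = g t) -> regular f -> regular g.
Proof. by move=> fg [N [p fE]]; exists N, p => t dt; rewrite -fg ?fE. Qed.

Lemma regularD f g : regular f -> regular g -> regular (fun t => f t + g t).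
Proof.
move=> [N [p fE]] [M [q gE]].
exists (N + M)%N, (p * delta ^+ M + q * delta ^+ N) => t dt.
rewrite rmorphD !rmorphM !rmorphXn -fE // -gE // exprD mulrDl !mulrA.
by congr (_ + _); rewrite mulrAC.
Qed.

Lemma regularM f g : regular f -> regular g -> regular (fun t => f t * g t).
Proof.
move=> [N [p fE]] [M [q gE]]; exists (N + M)%N, (p * q) => t dt.
by rewrite rmorphM -fE // -gE // exprD mulrACA.
Qed.

Lemma regular_sum I (r : seq I) (f : I -> T -> F) :
  (forall i, regular (f i)) -> regular (fun t => \sum_(i <- r) f i t).
Proof.
move=> regf; elim: r => [|i r IH].
  by apply: eq_regular (regular_cst 0) => t _; rewrite big_nil.
by apply: eq_regular (regularD (regf i) IH) => t _; rewrite big_cons.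
Qed.

Lemma regularX f k : regular f -> regular (fun t => f t ^+ k).
Proof.
move=> regf; elim: k => [|k IH].
  by apply: eq_regular (regular_cst 1) => t _; rewrite expr0.
by apply: eq_regular (regularM regf IH) => t _; rewrite exprS.
Qed.

Lemma regular_prod I (r : seq I) (f : I -> T -> F) :
  (forall i, regular (f i)) -> regular (fun t => \prod_(i <- r) f i t).
Proof.
move=> regf; elim: r => [|i r IH].
  by apply: eq_regular (regular_cst 1) => t _; rewrite big_nil.
by apply: eq_regular (regularM (regf i) IH) => t _; rewrite big_cons.
Qed.

Lemma regular_meval k (f : 'I_k -> T -> F) (P : {mpoly F[k]}) :
  (forall i, regular (f i)) -> regular (fun t => P.@[fun i => f i t]).
Proof.
move=> regf; apply: eq_regular (regular_sum (msupp P) (f := fun a t =>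
    P@_a * \prod_(i < k) f i t ^+ a i) _).
  by move=> t _; rewrite mevalE.
move=> a; apply: regularM; first exact: regular_cst.
by apply: regular_prod => i; apply: regularX.
Qed.

Definition regular_mx a b (M : T -> 'M[F]_(a, b)) : Prop :=
  forall i j, regular (fun t => M t i j).

Lemma regular_mx_ev a b (M : 'M[R]_(a, b)) :
  regular_mx (fun t => map_mx (ev t) M).
Proof.
by move=> i j; apply: eq_regular (regular_ev (M i j)) => t _; rewrite mxE.
Qed.

Lemma regular_mulmx a b c (M : T -> 'M[F]_(a, b)) (N : T -> 'M[F]_(b, c)) :
  regular_mx M -> regular_mx N -> regular_mx (fun t => M t *m N t).
Proof.
move=> regM regN i j.
apply: eq_regular (regular_sum (index_enum 'I_b)
  (f := fun k t => M t i k * N t k j) _) => [t _|k]; first by rewrite mxE.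
exact: regularM.
Qed.

Lemma regular_invmx n (G : 'M[R]_n) :
  delta = \det G -> regular_mx (fun t => invmx (map_mx (ev t) G)).
Proof.
move=> defd i j; exists 1%N, (\adj G i j) => t dt.
have Gt : \det (map_mx (ev t) G) = ev t delta by rewrite det_map_mx defd.
rewrite /invmx unitmxE Gt unitfE dt mxE expr1 mulrAC mulVf // mul1r.
by rewrite -map_mx_adj mxE.
Qed.

End RegularFunctions.

Lemma msizeM_bound (F : fieldType) (d a b : nat) (p q : {mpoly F[d]}) :
  (msize p <= a.+1)%N -> (msize q <= b.+1)%N -> (msize (p * q) <= (a + b).+1)%N.
Proof.
have [->|p0] := eqVneq p 0; first by rewrite mul0r msize0.
have [->|q0] := eqVneq q 0; first by rewrite mulr0 msize0.
move=> pa qb; rewrite msizeM //.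
by have := leq_add pa qb; rewrite addSn addnS; case: (_ + _)%N => //= s /ltnW.
Qed.

Lemma msizeX_bound (F : fieldType) (d a k : nat) (p : {mpoly F[d]}) :
  (msize p <= a.+1)%N -> (msize (p ^+ k) <= (k * a).+1)%N.
Proof.
move=> pa; elim: k => [|k IH]; first by rewrite expr0 msize1.
by rewrite exprS mulSn; apply: msizeM_bound.
Qed.

Lemma msize_prod_bound (F : fieldType) (d a k : nat) (p : 'I_k -> {mpoly F[d]}) :
    (forall i, msize (p i) <= a.+1)%N ->
  (msize (\prod_(i < k) p i) <= (k * a).+1)%N.
Proof.
move=> pa; elim: k p pa => [|k IH] p pa; first by rewrite big_ord0 msize1.
by rewrite big_ord_recl mulSn; apply: msizeM_bound => //; apply: IH.
Qed.

Lemma card_bmultinom_le d b : (#|{: 'X_{1..d < b}}| <= b ^ d)%N.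
Proof.
have lt_b (m : 'X_{1..d < b}) i : (m i < b)%N.
  by apply: leq_ltn_trans (bmdeg m); rewrite mdegE (bigD1 i) //= leq_addr.
have := @leq_card _ {ffun 'I_d -> 'I_b} (fun m => [ffun i => Ordinal (lt_b m i)]).
rewrite card_ffun !card_ord; apply=> m1 m2 /ffunP eq_m.
by apply/val_inj/mnmP => i; have := eq_m i; rewrite !ffunE => -[].
Qed.

(** There are more than enough monomials of degree less than [M] in each of
    the [k] functions to exceed the dimension, of order [M ^ d], of the space
    of polynomials that contains their products once denominators are cleared. *)
Lemma regular_dependent (F : fieldType) (d k : nat) (delta : {mpoly F[d]})
    (f : 'I_k -> ('I_d -> F) -> F) :
    (d < k)%N ->
    (forall i, regular (fun t : 'I_d -> F => meval t) delta (f i)) ->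
  exists2 P : {mpoly F[k]}, P != 0 &
    forall t, delta.@[t] != 0 -> P.@[fun i => f i t] = 0.
Proof.
move=> ltdk /fin_all_exists[N /fin_all_exists[p fE]].
pose Nmax := \max_(i < k) N i; pose dl := delta ^+ Nmax.
pose q i := p i * delta ^+ (Nmax - N i).
have {}fE i t : delta.@[t] != 0 -> f i t * dl.@[t] = (q i).@[t].
  move=> dt; rewrite /dl /q mevalM -fE // !rmorphXn /= -mulrA -exprD.
  by rewrite subnKC // leq_bigmax.
have dl0 t : delta.@[t] != 0 -> dl.@[t] != 0.
  by move=> dt; rewrite rmorphXn expf_neq0.
clearbody dl; pose D := maxn (\max_(i < k) msize (q i)) (msize dl).
have qD i : (msize (q i) <= D.+1)%N.
  by apply: leqW; rewrite leq_max (leq_bigmax i).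
have dlD : (msize dl <= D.+1)%N by apply: leqW; rewrite leq_maxr.
(* [M] is large enough for [(k * (M * D) + 1) ^ d < M ^ k]. *)
pose M := ((k * D).+1 ^ d).+1; pose b := (k * (M * D)).+1.
pose E := {ffun 'I_k -> 'I_M}.
have ltbM : (b ^ d < #|{: E}|)%N.
  rewrite card_ffun !card_ord.
  have bM : (b <= M * (k * D).+1)%N.
    by rewrite /b mulnS mulnCA -addn1 addnC leq_add2r.
  apply: leq_ltn_trans (_ : M ^ d * (k * D).+1 ^ d < _)%N.
    by rewrite -expnMn; case: (d) => // d'; rewrite leq_exp2r.
  apply: leq_trans (_ : M ^ d.+1 <= _)%N; last by rewrite leq_exp2l ?ltnS ?expn_gt0.
  by rewrite expnSr ltn_pmul2l ?expn_gt0.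
pose G (a : E) : {mpoly F[d]} := \prod_(i < k) (q i ^+ a i * dl ^+ (M - a i)).
have sizeG a : (msize (G a) <= b)%N.
  apply: msize_prod_bound => i.
  have -> : (M * D = a i * D + (M - a i) * D)%N.
    by rewrite -mulnDl subnKC // ltnW.
  by apply: msizeM_bound; apply: msizeX_bound.
pose A := \matrix_(r < #|{: E}|, c < #|{: 'X_{1..d < b}}|)
            (G (enum_val r))@_(enum_val c).
have kerA : kermx A != 0.
  rewrite kermx_eq0 /row_free neq_ltn; apply/orP; left.
  apply: leq_ltn_trans (rank_leq_col A) _.
  exact: leq_ltn_trans (card_bmultinom_le d b) ltbM.
pose u := nz_row (kermx A).
have uA : u *m A = 0 by apply/sub_kermxP; apply: nz_row_sub.
have /rV0Pn[r0 ur0] : u != 0 by rewrite nz_row_eq0.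
have Gu : \sum_r u 0 r *: G (enum_val r) = 0.
  apply/mpolyP => m; rewrite raddf_sum mcoeff0 /=.
  have [mb|mb] := ltnP (mdeg m) b; last first.
    apply: big1 => r _; rewrite mcoeffZ memN_msupp_eq0 ?mulr0 //.
    by apply: msize_mdeg_ge; apply: leq_trans (sizeG _) mb.
  have /rowP/(_ (enum_rank (BMultinom mb))) := uA; rewrite !mxE => uAm.
  apply: etrans uAm.
  by apply: eq_bigr => r _; rewrite mxE mcoeffZ enum_rankK.
pose mon (a : E) : 'X_{1..k} := [multinom (a i : nat) | i < k].
have mon_inj : injective mon.
  move=> a1 a2 /mnmP eq_a; apply/ffunP => i; apply: val_inj.
  by have := eq_a i; rewrite !mnmE.
exists (\sum_r u 0 r *: 'X_[mon (enum_val r)]).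
  apply: contraNneq ur0 => P0.
  have := congr1 (mcoeff (mon (enum_val r0))) P0.
  rewrite mcoeff0 raddf_sum (bigD1 r0) //= mcoeffZ mcoeffX eqxx mulr1.
  rewrite big1 ?addr0 => [->//|r ner].
  by rewrite mcoeffZ mcoeffX (inj_eq mon_inj) (inj_eq enum_val_inj)
             (negPf ner) mulr0.
move=> t dt; have dlk0 : \prod_(i < k) dl.@[t] ^+ M != 0.
  by apply/prodf_neq0 => i _; rewrite expf_neq0 ?dl0.
apply: (mulIf dlk0); rewrite mul0r -(meval0 t) -Gu !raddf_sum mulr_suml /=.
apply: eq_bigr => r _; rewrite !mevalZ -mulrA; congr (_ * _).
rewrite mevalX rmorph_prod -big_split; apply: eq_bigr => i _ /=.
rewrite rmorphM !rmorphXn /= mnmE -fE // exprMn -mulrA -exprD.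
by rewrite subnKC // ltnW.
Qed.

(** * Nilpotent matrices *)

Definition bool_mx (F : fieldType) a b (M : 'M[bool]_(a, b)) : 'M[F]_(a, b) :=
  \matrix_(i, j) (M i j)%:R.

Lemma bool_mx_block (F : fieldType) a b (M : 'M[bool]_a) (N : 'M[bool]_b) :
  bool_mx F (block_mx M (const_mx false) (const_mx false) N) =
  block_mx (bool_mx F M) 0 0 (bool_mx F N).
Proof.
apply/matrixP => i j.
by case: (split_ordP i) => i' ->; case: (split_ordP j) => j' ->;
  rewrite mxE ?(block_mxEul, block_mxEur, block_mxEdl, block_mxEdr) !mxE.
Qed.

(** A vector [e] on which the last nonzero power [X ^+ k] does not vanish spans
    a Jordan chain.  Pairing this chain with that of a linear form [phi] such that
    [e X^k phi != 0] gives a triangular Hankel matrix, so the vectors orthogonal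
    to the chain of [phi] form a stable complement. *)
Lemma nilpotent_split_chain (F : fieldType) n (X : 'M[F]_n) :
    (0 < n)%N -> nilpotent_mx X ->
  exists k r (P : 'M[F]_(k.+1, n)) (Q : 'M[F]_(n, k.+1)) (S : 'M[F]_(r, n))
         (X' : 'M[F]_r),
    [/\ (k.+1 + r = n)%N, P *m Q \in unitmx, S *m Q = 0 & row_free S] /\
    [/\ P *m X = bool_mx F (\matrix_(i, j) (j == i.+1 :> nat)) *m P
      & S *m X = X' *m S].
Proof.
move=> n0 nilX.
have exX : exists k, X ^+ k == 0 by have [k /eqP] := nilX; exists k.
case: (ex_minnP exX) => -[|k] /eqP Xk minX.
  by move/matrixP/(_ (Ordinal n0) (Ordinal n0))/eqP: Xk; rewrite expr0 !mxE oner_eq0.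
have /matrix0Pn[i0 [j0 X0]] : X ^+ k != 0.
  by apply: contraTneq (ltnSn k) => /eqP/minX; rewrite -leqNgt.
have X_high l : (k < l)%N -> X ^+ l = 0.
  by move=> kl; rewrite -(subnKC kl) exprD Xk mul0r.
pose P : 'M[F]_(k.+1, n) := \matrix_(i < k.+1) row i0 (X ^+ i).
pose Q : 'M[F]_(n, k.+1) := \matrix_(i < n, j < k.+1) (X ^+ (k - j)) i j0.
have PQE (i j : 'I_k.+1) : (P *m Q) i j = (X ^+ (i + (k - j))) i0 j0.
  by rewrite exprD !mxE; apply: eq_bigr => l _; rewrite !mxE.
have PQu : P *m Q \in unitmx.
  rewrite -unitmx_tr unitmxE det_trig ?unitfE.
    by apply/prodf_neq0 => i _; rewrite mxE PQE subnKC // -ltnS.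
  apply/is_trig_mxP => i j ij; rewrite mxE PQE X_high ?mxE //.
  by rewrite -{1}(subnKC (ltn_ord i : i <= k)%N) ltn_add2r.
have XQ : X *m Q = Q *m (\matrix_(i, j) (i.+1 == j :> nat)%:R : 'M_k.+1).
  apply/matrixP => i j; rewrite [RHS]mxE.
  have -> : (X *m Q) i j = (X ^+ (k - j).+1) i j0.
    by rewrite exprS !mxE; apply: eq_bigr => l _; rewrite !mxE.
  case: j => -[|j] ltj /=.
    rewrite subn0 Xk mxE big1 // => l _.
    by rewrite !mxE mulr0.
  rewrite (bigD1 (Ordinal (ltnW ltj))) //= !mxE eqxx mulr1 big1 ?addr0.
    by rewrite -subSn.
  move=> l /negPf nl; rewrite !mxE eqSS.
  by rewrite -[(l : nat) == j]/(l == Ordinal (ltnW ltj)) nl mulr0.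
have QX : kermx Q *m X *m Q = 0 by rewrite -mulmxA XQ mulmxA mulmx_ker mul0mx.
have rkQ : \rank Q = k.+1.
  apply/eqP; rewrite eqn_leq rank_leq_col /=.
  by apply: leq_trans (mxrankM_maxr P Q); rewrite mxrank_unit.
have : (row_base (kermx Q) *m X <= row_base (kermx Q))%MS.
  rewrite eq_row_base; apply/sub_kermxP.
  have /submxP[D ->] : (row_base (kermx Q) <= kermx Q)%MS by rewrite eq_row_base.
  by rewrite -!(mulmxA D) QX mulmx0.
case/submxP=> X' SX.
exists k, (\rank (kermx Q)), P, Q, (row_base (kermx Q)), X'; split; split=> //.
- by rewrite mxrank_ker rkQ subnKC // -rkQ rank_leq_row.
- by apply/sub_kermxP; rewrite eq_row_base.
- exact: row_base_free.
apply/row_matrixP => i; rewrite !row_mul.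
have -> : row i P *m X = row i0 (X ^+ i.+1).
  by rewrite rowK -row_mul exprSr.
have [ik|ik] := ltnP i.+1 k.+1.
  have -> : row i (bool_mx F (\matrix_(i, j) (j == i.+1 :> nat))) =
            delta_mx 0 (Ordinal ik).
    by apply/rowP => j; rewrite !mxE eqxx.
  by rewrite -rowE rowK.
rewrite X_high // linear0.
have -> : row i (bool_mx F (\matrix_(i, j) (j == i.+1 :> nat))) = 0 :> 'rV_k.+1.
  by apply/rowP => j; rewrite !mxE (ltn_eqF (leq_trans (ltn_ord j) ik)).
by rewrite mul0mx.
Qed.

Lemma nilpotent_conj_stable (F : fieldType) r n (S : 'M[F]_(r, n)) (X : 'M_n)
    (X' : 'M_r) :
  row_free S -> S *m X = X' *m S -> nilpotent_mx X -> nilpotent_mx X'.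
Proof.
move=> freeS SX [k Xk]; exists k; apply: (row_free_inj freeS).
have SXk l : S *m X ^+ l = X' ^+ l *m S.
  elim: l => [|l IH]; first by rewrite !expr0 mulmx1 mul1mx.
  by rewrite !exprS -[_ * _]/(_ *m _) mulmxA SX -mulmxA IH mulmxA.
by rewrite -SXk Xk mulmx0 mul0mx.
Qed.

(** Splitting off Jordan chains one at a time.  Only two features of the result
    matter: there are finitely many boolean matrices [b], and the diagonal is
    zero, which gives the trace. *)
Lemma nilpotent_normal_form (F : fieldType) n (X : 'M[F]_n) :
    nilpotent_mx X ->
  exists (b : 'M[bool]_n) (g : 'M[F]_n),
    [/\ g \in unitmx, g *m X = bool_mx F b *m g & forall i, b i i = false].
Proof.
elim/ltn_ind: n X => -[|n] IH X nilX.
  exists (const_mx false), 1%:M; split; first exact: unitmx1.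
    by apply/matrixP => -[].
  by case.
have [k [r [P [Q [S [X' [[defn PQ SQ freeS] [PX SX]]]]]]]] :=
  nilpotent_split_chain (ltn0Sn n) nilX.
have ltr : (r < n.+1)%N by rewrite -defn addSn ltnS leq_addl.
move: (nilpotent_conj_stable freeS SX nilX) => /(IH r ltr)[b [g [gu gX b0]]].
clear IH ltr; move: n.+1 => n1 in X nilX defn P Q S PQ SQ freeS PX SX *.
case: n1 / defn X nilX P Q S PQ SQ freeS PX SX => X nilX P Q S PQ SQ freeS PX SX.
exists (block_mx (\matrix_(i, j) (j == i.+1 :> nat)) (const_mx false)
                 (const_mx false) b).
exists (col_mx P (g *m S)); split.
- rewrite -row_free_unit -kermx_eq0; apply/rowV0P => u /sub_kermxP.
  rewrite -[u]hsubmxK mul_row_col => uPS.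
  have u1 : lsubmx u = 0.
    have : (lsubmx u *m P + rsubmx u *m (g *m S)) *m Q = 0.
      by rewrite uPS mul0mx.
    rewrite mulmxDl -!mulmxA SQ !mulmx0 addr0 => uPQ.
    by rewrite -[lsubmx u](mulmxK PQ) uPQ mul0mx.
  move: uPS; rewrite u1 mul0mx add0r mulmxA => uS.
  have /(congr1 (mulmx^~ (invmx g))) : rsubmx u *m g = 0.
    by apply: (row_free_inj freeS); rewrite uS mul0mx.
  by rewrite mulmxK // mul0mx => ->; rewrite row_mx0.
- rewrite bool_mx_block mul_col_mx mul_block_col !mul0mx addr0 add0r PX.
  by rewrite -mulmxA SX !mulmxA gX.
move=> i; case: (split_ordP i) => i' ->; rewrite ?block_mxEul ?block_mxEdr //.
by rewrite mxE ltn_eqF.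
Qed.

Lemma mxtrace_conj (F : fieldType) n (g X Y : 'M[F]_n) :
  g \in unitmx -> g *m X = Y *m g -> \tr X = \tr Y.
Proof.
move=> gu gX; have -> : X = invmx g *m (Y *m g) by rewrite -gX mulKmx.
by rewrite mxtrace_mulC mulmxK.
Qed.

Lemma nilpotent_trace0 (F : fieldType) n (X : 'M[F]_n) :
  nilpotent_mx X -> \tr X = 0.
Proof.
move=> /nilpotent_normal_form[b [g [gu /(mxtrace_conj gu)-> b0]]].
by apply: big1 => i _; rewrite mxE b0.
Qed.

(** On the stable range of [X], where it is invertible, the relation reads
    [B X^-1 - X^-1 B = 1]; taking traces, the dimension of this range vanishes in
    the field. *)
Lemma commutator_square_nilpotent (F : fieldType) n (X B : 'M[F]_n) :
    (forall k, (0 < k <= n)%N -> k%:R != 0 :> F) ->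
  X * B - B * X = X * X -> nilpotent_mx X.
Proof.
move=> charF XB.
have XB' : X * B = B * X + X * X by rewrite -XB addrC subrK.
pose rk k := \rank (X ^+ k).
(* The stable range is that of the power [X ^+ k] of least rank [r]. *)
have exr : exists r, `[< exists k, rk k = r >].
  by exists (rk 0%N); apply/asboolP; exists 0%N.
case: (ex_minnP exr) => r /asboolP[k rkk] minr.
have XkB : X ^+ k * B = (B + X *+ k) * X ^+ k.
  elim: (k) => [|l IH]; first by rewrite !expr0 mulr0n addr0 mulr1 mul1r.
  rewrite exprS -mulrA IH !mulrA; congr (_ * _).
  by rewrite mulrDr mulrDl XB' mulrnAr mulrnAl mulrS addrA.
pose S := row_base (X ^+ k); have freeS : row_free S := row_base_free _.
have stableS Y Z : X ^+ k * Y = Z * X ^+ k -> exists Y', S *m Y = Y' *m S.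
  move=> XkY; apply/submxP; rewrite eq_row_base.
  have /submxP[D ->] : (S <= X ^+ k)%MS by rewrite eq_row_base.
  rewrite -mulmxA -[_ ^+ _ *m _]/(_ * _) XkY -[_ * _]/(_ *m _) mulmxA.
  exact: submxMl.
have [X1 SX] : exists X1, S *m X = X1 *m S.
  by apply: (stableS X X); rewrite -exprSr -exprS.
have [B1 SB] := stableS _ _ XkB.
have X1u : X1 \in unitmx.
  rewrite -row_free_unit /row_free eqn_leq rank_leq_row /=.
  apply: leq_trans (mxrankM_maxl X1 S); rewrite -SX (eqmxMr _ (eq_row_base _)).
  rewrite -[_ *m X]/(_ * _) -exprSr -/(rk k) rkk.
  by apply: minr; apply/asboolP; exists k.+1.
clearbody S; have X1B1 : X1 *m B1 - B1 *m X1 = X1 *m X1.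
  apply: (row_free_inj freeS); rewrite mulmxBl -!mulmxA -SX -SB !mulmxA -SX -SB.
  by rewrite -!mulmxA -mulmxBr -[X *m B]/(X * B) XB' -[B *m X]/(B * X) addrC addKr.
have B1X1 : B1 *m invmx X1 - invmx X1 *m B1 = 1%:M.
  have : invmx X1 *m (X1 *m B1 - B1 *m X1) *m invmx X1 =
         invmx X1 *m (X1 *m X1) *m invmx X1 by rewrite X1B1.
  by rewrite mulmxBr mulmxBl mulKmx // mulmxA mulmxK // mulKmx // mulmxV.
have rk0 : (rk k)%:R = 0 :> F.
  by rewrite -mxtrace1 -B1X1 raddfB /= mxtrace_mulC subrr.
exists k; apply/eqP; rewrite -mxrank_eq0 -/(rk k).
apply: contraT => rkN0; have := charF (rk k).
by rewrite lt0n rkN0 rank_leq_row rk0 eqxx; apply.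
Qed.

(** * Conjugates of pairs, as regular functions of the conjugating matrix *)

(** The pair [(A, B)] with [A - B = X]: in terms of [X] the equation
    [A^2 - 2AB + B^2 = 0] becomes the linear condition [XB - BX = X^2] on [B]. *)
Definition pair_point (F : fieldType) n (X B : 'M[F]_n) : 'rV[F]_(n * n + n * n) :=
  mx_pair_coords (X + B, B).

Lemma pair_point_left (F : fieldType) n (X B : 'M[F]_n) i j :
  pair_point X B 0 (lshift _ (mxvec_index i j)) = X i j + B i j.
Proof. by rewrite row_mxEl mxvecE mxE. Qed.

Lemma pair_point_right (F : fieldType) n (X B : 'M[F]_n) i j :
  pair_point X B 0 (rshift _ (mxvec_index i j)) = B i j.
Proof. by rewrite row_mxEr mxvecE. Qed.

Definition conj_mx (F : fieldType) n (g X : 'M[F]_n) : 'M[F]_n :=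
  invmx g *m X *m g.

Definition conj_point (F : fieldType) n (g X B : 'M[F]_n) :=
  pair_point (conj_mx g X) (conj_mx g B).

Lemma conj_mxM (F : fieldType) n (g h X : 'M[F]_n) :
  g \in unitmx -> h \in unitmx -> conj_mx (g *m h) X = conj_mx h (conj_mx g X).
Proof.
move=> gu hu; rewrite /conj_mx.
suff -> : invmx (g *m h) = invmx h *m invmx g by rewrite !mulmxA.
have ghu : g *m h \in unitmx by rewrite unitmx_mul gu.
apply: (can_inj (mulKmx ghu)); rewrite mulmxV //.
by rewrite mulmxA mulmxK // mulmxV.
Qed.

Lemma conj_mx_commute (F : fieldType) n (g X : 'M[F]_n) :
  g \in unitmx -> g *m X = X *m g -> conj_mx g X = X.
Proof. by move=> gu gX; rewrite /conj_mx -mulmxA -gX mulKmx. Qed.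

Lemma conj_mx_mul (F : fieldType) n (g X Y : 'M[F]_n) :
  g \in unitmx -> conj_mx g (X *m Y) = conj_mx g X *m conj_mx g Y.
Proof. by move=> gu; rewrite /conj_mx !mulmxA mulmxK. Qed.

Lemma conj_mxB (F : fieldType) n (g X Y : 'M[F]_n) :
  conj_mx g (X - Y) = conj_mx g X - conj_mx g Y.
Proof. by rewrite /conj_mx mulmxBr mulmxBl. Qed.

Lemma conj_mx_trace (F : fieldType) n (g X : 'M[F]_n) :
  g \in unitmx -> \tr (conj_mx g X) = \tr X.
Proof. by move=> gu; rewrite /conj_mx mxtrace_mulC mulKVmx. Qed.

Lemma regular_conj_point (F : fieldType) (R : comNzRingType) (T : Type)
    (ev : T -> {rmorphism R -> F}) (cst : F -> R) n (G X B : 'M[R]_n)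
    (p : {mpoly F[n * n + n * n]}) :
    (forall t c, ev t (cst c) = c) ->
  regular ev (\det G) (fun t => p.@[conj_point
    (map_mx (ev t) G) (map_mx (ev t) X) (map_mx (ev t) B) 0]).
Proof.
move=> evC.
have regC Y : regular_mx ev (\det G)
    (fun t => conj_mx (map_mx (ev t) G) (map_mx (ev t) Y)).
  apply: (regular_mulmx evC); last exact: regular_mx_ev.
  apply: (regular_mulmx evC); last exact: regular_mx_ev.
  exact: regular_invmx.
apply: (regular_meval evC) => j.
case: (split_ordP j) => j' ->; case/mxvec_indexP: j' => a b;
  [apply: eq_regular (regularD (regC X a b) (regC B a b)) |
   apply: eq_regular (regC B a b)] => t _.
  exact/esym/pair_point_left.
exact/esym/pair_point_right.
Qed.

(** * The pairs with [A - B] in a fixed conjugacy class *)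

Section FixedClass.
Variables (F : closedFieldType) (n : nat) (J : 'M[F]_n).
Hypothesis n_neq0 : n%:R != 0 :> F.

Definition centralizer_mx : 'M[F]_(n * n) :=
  kermx (lin_mulmxr J - lin_mulmx J).

Lemma centralizer_mxP (c : 'M[F]_n) :
  reflect (c *m J = J *m c) (mxvec c <= centralizer_mx)%MS.
Proof.
apply: (iffP sub_kermxP); rewrite mulmxBr !mul_vec_lin /=.
  by move/eqP; rewrite subr_eq0 => /eqP/(can_inj mxvecK).
by move=> ->; rewrite subrr.
Qed.

Let C := centralizer_mx.
Let V : 'M[F]_(n * n) := C^C%MS.

Let CV0 : (C :&: V = 0)%MS. Proof. exact: capmx_compl. Qed.
Let VC0 : (V :&: C = 0)%MS. Proof. by rewrite capmxC CV0. Qed.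

Let subCV m (A : 'M[F]_(m, n * n)) : (A <= C + V)%MS.
Proof. exact/submx_full/addsmx_compl_full. Qed.

Let oneC : (mxvec 1%:M <= C)%MS.
Proof. by apply/centralizer_mxP; rewrite mulmx1 mul1mx. Qed.

Let trace_col : 'cV[F]_(n * n) := \col_k \tr (vec_mx (delta_mx 0 k)).

Let trace_colE (v : 'rV[F]_(n * n)) : (v *m trace_col) 0 0 = \tr (vec_mx v).
Proof.
rewrite [in RHS](row_sum_delta v) !linear_sum mxE /=.
by apply: eq_bigr => k _; rewrite !linearZ mxE.
Qed.

Definition traceless_centralizer_mx : 'M[F]_(n * n) :=
  (centralizer_mx :&: kermx trace_col)%MS.

Let T := traceless_centralizer_mx.

Lemma traceless_centralizer_mxP (c : 'M[F]_n) :
  c *m J = J *m c -> \tr c = 0 -> (mxvec c <= T)%MS.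
Proof.
move=> cJ trc; rewrite sub_capmx; apply/andP; split; first exact/centralizer_mxP.
by apply/sub_kermxP/rowP => i; rewrite ord1 trace_colE mxvecK trc mxE.
Qed.

(** Here the dimension drops from [n^2] to [n^2 - 1]: the identity commutes with
    [J] but its trace [n] is not zero, so the matrices of trace zero form a proper
    subspace of the centralizer. *)
Lemma slice_parameters : (\rank V + \rank T < n ^ 2)%N.
Proof.
have ltTC : (\rank T < \rank C)%N.
  apply: rank_ltmx; rewrite /ltmx capmxSl /=; apply: contra n_neq0 => CT.
  have /sub_kermxP/rowP/(_ 0) := submx_trans (submx_trans oneC CT) (capmxSr _ _).
  by rewrite trace_colE mxvecK mxtrace1 mxE => ->.
rewrite mxrank_compl -mulnn -[X in (_ < X)%N](subnK (rank_leq_col C)).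
by rewrite ltn_add2l.
Qed.

(** Multiplying by the centralizer of [J] on the left brings a generic matrix [g]
    into the affine space [1 + V], which has the right dimension because [V] is a
    complement of the centralizer.  The line from [g] to [1] serves as a family of
    generic matrices: the element of the centralizer is the solution of a linear
    system that is nonsingular at [1]. *)
Lemma generic_slice (g : 'M[F]_n) :
  exists2 q : {poly F}, q != 0 & forall x, q.[x] != 0 ->
    exists c : 'M[F]_n, let gx := g + x *: (1%:M - g) in
    [/\ c \in unitmx, gx \in unitmx, c *m J = J *m c &
        (mxvec (c *m gx - 1%:M) <= V)%MS].
Proof.
pose pC := proj_mx C V; pose pV := proj_mx V C.
pose cst a b (A : 'M[F]_(a, b)) := map_mx (@polyC F) A.
pose gP : 'M[{poly F}]_n := cst _ _ g + 'X *: cst _ _ (1%:M - g).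
pose MP := cst _ _ pV + cst _ _ pC *m lin_mulmxr gP.
pose cP := vec_mx (mxvec 1%:M *m \adj MP *m cst _ _ pC).
pose ev x : {rmorphism {poly F} -> F} := horner_eval x.
have evcst x a b (A : 'M[F]_(a, b)) : map_mx (ev x) (cst _ _ A) = A.
  by apply/matrixP => i j; rewrite !mxE /= horner_evalE hornerC.
pose gx x := g + x *: (1%:M - g).
have gPE x : map_mx (ev x) gP = gx x.
  by rewrite map_mxD map_mxZ !evcst /= horner_evalE hornerX.
pose Mx x := pV + pC *m lin_mulmxr (gx x).
have MPE x : map_mx (ev x) MP = Mx x.
  rewrite map_mxD map_mxM !evcst; congr (_ + _ *m _).
  by apply: map_lin_mx => A; rewrite /= map_mxM gPE.
have cPE x : map_mx (ev x) cP = vec_mx (mxvec 1%:M *m \adj (Mx x) *m pC).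
  by rewrite map_vec_mx !map_mxM map_mxvec map_mx1 map_mx_adj MPE evcst.
exists (\det MP * \det cP * \det gP).
  have gx1 : gx 1 = 1%:M by rewrite /gx scale1r addrC subrK.
  have Mx1 : Mx 1 = 1%:M.
    apply/row_matrixP => i; rewrite rowE [in RHS]rowE mulmx1.
    rewrite /Mx gx1 mulmxDr mulmxA.
    have -> : lin_mulmxr 1%:M = 1%:M :> 'M[F]_(n * n).
      apply/row_matrixP => k; rewrite rowE mul_rV_lin /= mulmx1 vec_mxK.
      by rewrite rowE mulmx1.
    by rewrite mulmx1 addrC add_proj_mx.
  apply: contraTneq (oner_neq0 F) => /(congr1 (ev 1)).
  rewrite !rmorphM -!det_map_mx gPE MPE cPE gx1 Mx1 adj1 mulmx1.
  by rewrite proj_mx_id // mxvecK !det1 !mulr1 rmorph0 => ->; rewrite eqxx.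
move=> x; rewrite -horner_evalE -/(ev x) !rmorphM -!det_map_mx gPE MPE cPE.
rewrite !mulf_eq0 !negb_or -!andbA => /and3P[detM detc detg].
set y := mxvec 1%:M *m invmx (Mx x).
have Mu : Mx x \in unitmx by rewrite unitmxE unitfE.
have yM : y *m pV + y *m pC *m lin_mulmxr (gx x) = mxvec 1%:M.
  by rewrite -mulmxA -mulmxDr mulmxKV.
pose c := vec_mx (y *m pC); exists c.
have cgE : c *m gx x = 1%:M - vec_mx (y *m pV).
  have := congr1 vec_mx yM; rewrite linearD mxvecK mul_rV_lin /= mxvecK => <-.
  by rewrite addrAC subrr add0r.
have cu : c \in unitmx.
  move: detc; rewrite -unitfE -unitmxE.
  have -> : \adj (Mx x) = \det (Mx x) *: invmx (Mx x).
    by rewrite /invmx Mu scalerA mulfV // scale1r.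
  by rewrite -scalemxAr -scalemxAl linearZ unitmxZ // unitfE.
have gu : gx x \in unitmx by rewrite unitmxE unitfE.
split=> //.
  by apply/centralizer_mxP; rewrite vec_mxK proj_mx_sub.
by rewrite cgE addrAC subrr add0r linearN /= vec_mxK eqmx_opp proj_mx_sub.
Qed.

(** The pairs with [g] in the slice are parametrized by [V] and by the matrices
    of trace zero in the centralizer, these being the differences of solutions. *)
Lemma slice_dependent k (f : 'I_k -> {mpoly F[n * n + n * n]}) :
    (n ^ 2 <= k)%N ->
  exists2 P : {mpoly F[k]}, P != 0 & forall s B : 'M[F]_n,
    s \in unitmx -> (mxvec (s - 1%:M) <= V)%MS ->
    J *m B - B *m J = J *m J -> \tr B = 0 ->
    P.@[fun i => (f i).@[conj_point s J B 0]] = 0.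
Proof.
move=> kn.
have [[B0 [JB0 trB0]] | noB] := pselect (exists B : 'M[F]_n,
    J *m B - B *m J = J *m J /\ \tr B = 0); last first.
  by exists 1; [apply: oner_neq0 | move=> s B _ _ JB trB; case: noB; exists B].
pose d := (\rank V + \rank T)%N.
pose X : 'rV[{mpoly F[d]}]_d := \row_i 'X_i.
pose cst a b (A : 'M[F]_(a, b)) := map_mx (@mpolyC d F) A.
pose SP : 'M[{mpoly F[d]}]_n :=
  1%:M + vec_mx (lsubmx X *m cst _ _ (row_base V)).
pose BP : 'M[{mpoly F[d]}]_n :=
  cst _ _ B0 + vec_mx (rsubmx X *m cst _ _ (row_base T)).
pose ev (t : 'I_d -> F) : {rmorphism {mpoly F[d]} -> F} := meval t.
have evcst t a b (A : 'M[F]_(a, b)) : map_mx (ev t) (cst _ _ A) = A.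
  by apply/matrixP => i j; rewrite !mxE /= mevalC.
pose Phi i t := (f i).@[conj_point (map_mx (ev t) SP)
  (map_mx (ev t) (cst _ _ J)) (map_mx (ev t) BP) 0].
have [||P P0 PE] := @regular_dependent F d k (\det SP) Phi.
- exact: leq_trans slice_parameters kn.
- move=> i; have evC t c : ev t c%:MP = c by apply: mevalC.
  exact: regular_conj_point evC.
exists P => // s B su sV JB trB.
have /submxP[v1 sE] : (mxvec (s - 1%:M) <= row_base V)%MS by rewrite eq_row_base.
have /submxP[v2 BE] : (mxvec (B - B0) <= row_base T)%MS.
  rewrite eq_row_base; apply: traceless_centralizer_mxP; last first.
    by rewrite raddfB /= trB trB0 subrr.
  have JBE Y : J *m Y - Y *m J = J *m J -> J *m Y = J *m J + Y *m J.
    by move=> <-; rewrite subrK.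
  by rewrite mulmxBl mulmxBr (JBE B) // (JBE B0) // opprD addrACA subrr add0r.
pose t i := row_mx v1 v2 0 i.
have evX : map_mx (ev t) X = row_mx v1 v2.
  by apply/rowP => i; rewrite [LHS]mxE mxE /= mevalXU.
have SPE : map_mx (ev t) SP = s.
  rewrite map_mxD map_mx1 map_vec_mx map_mxM evcst map_lsubmx evX row_mxKl.
  by rewrite -sE mxvecK addrC subrK.
have BPE : map_mx (ev t) BP = B.
  rewrite map_mxD map_vec_mx map_mxM !evcst map_rsubmx evX row_mxKr.
  by rewrite -BE mxvecK addrC subrK.
have := PE t; rewrite -[(\det SP).@[t]]/(ev t _) -det_map_mx SPE.
rewrite -unitfE -unitmxE => /(_ su); rewrite /Phi SPE BPE evcst.
exact.
Qed.

(** The relation found on the slice holds on the whole class: on the line of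
    [generic_slice] it is a rational identity that holds at all but finitely many
    points, hence at [g]. *)
Lemma class_dependent k (f : 'I_k -> {mpoly F[n * n + n * n]}) :
    (n ^ 2 <= k)%N ->
  exists2 P : {mpoly F[k]}, P != 0 & forall g B : 'M[F]_n,
    g \in unitmx -> J *m B - B *m J = J *m J -> \tr B = 0 ->
    P.@[fun i => (f i).@[conj_point g J B 0]] = 0.
Proof.
move=> /slice_dependent-/(_ f)[P P0 PE]; exists P => // g B gu JB trB.
have [q q0 qE] := generic_slice g.
pose ev x : {rmorphism {poly F} -> F} := horner_eval x.
pose cst (A : 'M[F]_n) := map_mx (@polyC F) A.
have evcst x A : map_mx (ev x) (cst A) = A.
  by apply/matrixP => i j; rewrite !mxE /= horner_evalE hornerC.
pose G := cst g + 'X *: cst (1%:M - g).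
have GE x : map_mx (ev x) G = g + x *: (1%:M - g).
  by rewrite map_mxD map_mxZ !evcst /= horner_evalE hornerX.
have evC x c : ev x c%:P = c by apply: hornerC.
have [N [p pE]] := regular_meval evC P
  (fun i => regular_conj_point G (cst J) (cst B) (f i) evC).
have detGE x : ev x (\det G) = \det (g + x *: (1%:M - g)).
  by rewrite -det_map_mx GE.
have p0 : p = 0.
  have /eqP : p * q = 0.
    apply: contraTeq isT => /closed_nonrootP[x].
    rewrite rootE hornerM mulf_eq0 negb_or => /andP[px0 qx0].
    have [c [cu gxu cJ cV]] := qE x qx0.
    have sE : g + x *: (1%:M - g) = invmx c *m (c *m (g + x *: (1%:M - g))).
      by rewrite mulKmx.
    have := pE x; rewrite detGE -unitfE -unitmxE => /(_ gxu).
    rewrite GE !evcst {1}sE -[ev x p]/p.[x] => pxE.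
    case/negP: px0; rewrite -pxE.
    set w := fun i => _; suff -> : P.@[w] = 0 by rewrite mul0r.
    have cVu : invmx c \in unitmx by rewrite unitmx_inv.
    have su : c *m (g + x *: (1%:M - g)) \in unitmx by rewrite unitmx_mul cu.
    have cVJ : conj_mx (invmx c) J = J.
      apply: conj_mx_commute => //; apply: (can_inj (mulKmx cu)).
      by rewrite mulKVmx // mulmxA cJ mulmxK.
    rewrite -(PE _ (conj_mx (invmx c) B) su cV).
    - by apply: meval_eq => i; rewrite /w /conj_point !conj_mxM // cVJ.
    - by rewrite -{1 2}cVJ -!conj_mx_mul // -conj_mxB JB conj_mx_mul // cVJ.
    by rewrite conj_mx_trace.
  by rewrite mulf_eq0 (negPf q0) orbF => /eqP.
have := pE 0; rewrite detGE scale0r addr0 -unitfE -unitmxE => /(_ gu).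
rewrite GE !evcst scale0r addr0 p0 rmorph0 => /eqP.
rewrite mulf_eq0 expf_eq0 -[\det g == 0]negbK -unitfE -unitmxE gu.
by rewrite andbF orbF => /eqP.
Qed.

End FixedClass.

(** * Upper bound *)

Lemma conj_mxK (F : fieldType) n (g X : 'M[F]_n) :
  g \in unitmx -> conj_mx g (conj_mx (invmx g) X) = X.
Proof.
move=> gu; rewrite -conj_mxM ?unitmx_inv // mulVmx //.
by rewrite /conj_mx invmx1 mul1mx mulmx1.
Qed.

Lemma pair_equationE (R : pzRingType) (X B : R) :
  (X + B) ^+ 2 - ((X + B) * B) *+ 2 + B ^+ 2 = X * X - (X * B - B * X).
Proof.
rewrite mulr2n opprD addrA expr2 -mulrBr addrK -addrA mulrDl.
by rewrite [(X + B) * B]mulrDl opprD -(addrA (- (X * B))) -(expr2 B)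
  addNr addr0 -addrA opprB.
Qed.

(** One relation for each boolean normal form; their product is a relation on all
    of [U]. *)
Lemma U_dependent (F : closedFieldType) n k
    (f : 'I_k -> {mpoly F[n * n + n * n]}) :
    (0 < n)%N -> (forall l, (0 < l <= n)%N -> l%:R != 0 :> F) -> (n ^ 2 <= k)%N ->
  exists2 P : {mpoly F[k]}, P != 0 &
    forall A B, U (A, B) -> P.@[fun i => (f i).@[mx_pair_coords (A, B) 0]] = 0.
Proof.
move=> n0 charF nk.
have nF : n%:R != 0 :> F by apply: charF; rewrite n0 leqnn.
have /fin_all_exists2[P P0 PE] b := class_dependent (bool_mx F b) nF f nk.
exists (\prod_b P b) => [|A B [nilB AB]]; first exact/prodf_neq0.
pose X := A - B; have AE : A = X + B by rewrite subrK.
have XB : X * B - B * X = X * X.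
  by move: AB; rewrite AE pair_equationE => /eqP; rewrite subr_eq0 => /eqP.
have [b [g [gu gX _]]] := nilpotent_normal_form (commutator_square_nilpotent charF XB).
have Vgu : invmx g \in unitmx by rewrite unitmx_inv.
have XE : bool_mx F b = conj_mx (invmx g) X.
  by rewrite /conj_mx invmxK gX mulmxK.
rewrite rmorph_prod (bigD1 b) //= -[X in X * _ = _](_ : 0 = _) ?mul0r //.
rewrite -(PE b g (conj_mx (invmx g) B)) //.
- apply: meval_eq => i.
  by rewrite /conj_point XE !conj_mxK // AE.
- by rewrite XE -!conj_mx_mul // -conj_mxB; congr conj_mx.
by rewrite conj_mx_trace // nilpotent_trace0.
Qed.

(** * A family of dimension [n^2 - 1] *)

Section GenericFamily.
Variable n' : nat.
Let n := n'.+1.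

(** The entries of the rows of [g] other than the first, then the coefficients of
    a polynomial in the Jordan block. *)
Definition family_index : finType := (('I_n' * 'I_n) + 'I_n')%type.

Lemma card_family_index : #|family_index| = (n ^ 2 - 1)%N.
Proof. by rewrite card_sum card_prod !card_ord -mulnn mulSn addnC addSn subn1. Qed.

Section OverRing.
Variable R : comNzRingType.
Implicit Type t : family_index -> R.

(** The first row of [g] is [e_0]: multiplying [g] on the left by a polynomial in
    the Jordan block does not change [g^-1 J g], and for a generic [g] this can be
    used to normalize the first row. *)
Definition family_g t : 'M[R]_n := \matrix_(i, j)
  ((i == j)%:R + if unlift ord0 i is Some i' then t (inl (i', j)) else 0).

Definition jordan_block : 'M[R]_n := \matrix_(i, j) (j == i.+1 :> nat)%:R.

Definition index_mx : 'M[R]_n := \matrix_(i, j) ((i == j)%:R * (i : nat)%:R).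

(** The diagonal matrix [D] of the indices satisfies [JD - DJ = J], so [DJ] is a
    particular solution of [JB - BJ = J^2], to which multiples of positive powers
    of [J] can be added.  The factor [J] on the right makes the whole strictly
    triangular. *)
Definition family_N t : 'M[R]_n :=
  (index_mx + \sum_(l < n') t (inr l) *: jordan_block ^+ l) * jordan_block.

Lemma jordan_index : jordan_block * index_mx - index_mx * jordan_block = jordan_block.
Proof.
apply/matrixP => i j; rewrite !mxE (bigD1 j) //= [X in _ - X](bigD1 i) //= !mxE.
rewrite !eqxx !big1 ?addr0; first last.
- by move=> a /negPf aj; rewrite [index_mx a j]mxE aj mul0r mulr0.
- by move=> a /negPf ai; rewrite [index_mx i a]mxE eq_sym ai !mul0r.
rewrite !mul1r; case: eqP => [->|_]; last by rewrite mul0r mulr0 subr0.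
by rewrite mul1r mulr1 -natr1 addrAC subrr add0r.
Qed.

Lemma family_commutator t :
  jordan_block * family_N t - family_N t * jordan_block = jordan_block * jordan_block.
Proof.
rewrite /family_N; set S := \sum_(l < n') _; rewrite mulrA -mulrBl.
suff -> : jordan_block * (index_mx + S) - (index_mx + S) * jordan_block = jordan_block.
  by [].
have SJ : jordan_block * S = S * jordan_block.
  rewrite mulr_sumr mulr_suml; apply: eq_bigr => l _.
  by rewrite -scalerAl -scalerAr -exprS -exprSr.
by rewrite mulrDr mulrDl SJ opprD addrACA subrr addr0 jordan_index.
Qed.

Lemma jordanX_row0 l (j : 'I_n) : (l < n)%N ->
  (jordan_block ^+ l) ord0 j = (j == l :> nat)%:R.
Proof.
elim: l j => [|l IH] j ln; first by rewrite expr0 mxE eq_sym.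
rewrite exprSr mxE (bigD1 (Ordinal (ltnW ln))) //= IH ?(ltnW ln) // eqxx mul1r mxE.
rewrite big1 ?addr0 // => a /negPf al; rewrite IH ?(ltnW ln) //.
by rewrite -[(a : nat) == l]/(a == Ordinal (ltnW ln)) al mul0r.
Qed.

Lemma family_N_row0 t (l : 'I_n') : (family_N t) ord0 (lift ord0 l) = t (inr l).
Proof.
have ln : (l < n)%N by rewrite ltnW // ltnS.
rewrite /family_N; set K := _ + _.
have K0 : K ord0 (Ordinal ln) = t (inr l).
  rewrite mxE mxE mulr0 add0r summxE (bigD1 l) //= mxE jordanX_row0 // eqxx mulr1.
  rewrite big1 ?addr0 // => a al; rewrite mxE jordanX_row0 /=; last first.
    by rewrite ltnW // ltnS.
  by rewrite -[(l : nat) == a]/(l == a) eq_sym (negPf al) mulr0.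
rewrite mxE (bigD1 (Ordinal ln)) //= K0 mxE lift0 eqxx mulr1.
rewrite big1 ?addr0 // => a /negPf al; rewrite [jordan_block a _]mxE lift0 eqSS.
by rewrite eq_sym -[(a : nat) == l]/(a == Ordinal ln) al mulr0.
Qed.

Lemma family_g_row0 t : row ord0 (family_g t) = delta_mx 0 ord0.
Proof.
by apply/rowP => j; rewrite !mxE unlift_none addr0 eqxx eq_sym.
Qed.

Definition upper_triangular_from d (M : 'M[R]_n) :=
  forall i j : 'I_n, (j < i + d)%N -> M i j = 0.

Lemma upperM d e M N :
    upper_triangular_from d M -> upper_triangular_from e N ->
  upper_triangular_from (d + e) (M * N).
Proof.
move=> uM uN i j ji; rewrite mxE; apply: big1 => a _.
have [ai|ai] := ltnP a (i + d); first by rewrite uM ?mul0r.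
by rewrite uN ?mulr0 //; apply: leq_trans ji _; rewrite addnA leq_add2r.
Qed.

Lemma upperX d M k :
  upper_triangular_from d M -> upper_triangular_from (k * d) (M ^+ k).
Proof.
move=> uM; elim: k => [|k IH]; last by rewrite exprS mulSn; apply: upperM.
by move=> i j ji; rewrite expr0 mxE -val_eqE gtn_eqF // -[X in (_ < X)%N]addn0.
Qed.

Lemma upper_jordan : upper_triangular_from 1 jordan_block.
Proof. by move=> i j; rewrite addn1 => ji; rewrite mxE ltn_eqF. Qed.

Lemma family_N_nilpotent t : family_N t ^+ n = 0.
Proof.
have uK : upper_triangular_from 0
    (index_mx + \sum_(l < n') t (inr l) *: jordan_block ^+ l).
  move=> i j ji; rewrite addn0 in ji; rewrite mxE mxE -val_eqE gtn_eqF // mul0r add0r.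
  rewrite summxE big1 // => l _; rewrite mxE (upperX (k := l) upper_jordan) ?mulr0 //.
  exact: ltn_addr.
have uN := upperX (k := n) (upperM uK upper_jordan).
apply/matrixP => i j; rewrite uN ?mxE //.
by rewrite muln1 (leq_trans (ltn_ord j)) // leq_addl.
Qed.

End OverRing.

Section MapFamily.
Variables (R S : comNzRingType) (f : {rmorphism R -> S}).

Lemma map_family_g t : map_mx f (family_g t) = family_g (f \o t).
Proof.
apply/matrixP => i j; rewrite !mxE rmorphD rmorph_nat; congr (_ + _).
by case: unliftP => [a|] _ //=; rewrite rmorph0.
Qed.

Lemma map_jordan_block : map_mx f (jordan_block R) = jordan_block S.
Proof. by apply/matrixP => i j; rewrite !mxE rmorph_nat. Qed.

Lemma map_family_N t : map_mx f (family_N t) = family_N (f \o t).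
Proof.
rewrite /family_N map_mxM map_mxD /= map_jordan_block; congr ((_ + _) * _).
  apply/matrixP => i j; rewrite !mxE. by rewrite rmorphM !rmorph_nat.
apply/matrixP => i j; rewrite mxE !summxE rmorph_sum; apply: eq_bigr => l _.
rewrite [in LHS]mxE [RHS]mxE rmorphM.
by rewrite -map_jordan_block -(rmorphXn (map_mx f)) [in RHS]mxE.
Qed.

End MapFamily.

End GenericFamily.

Section CoordinateMatrices.
Variables (F : fieldType) (n : nat).

Definition coordA : 'M[{mpoly F[n * n + n * n]}]_n :=
  \matrix_(i, j) 'X_(lshift _ (mxvec_index i j)).
Definition coordB : 'M[{mpoly F[n * n + n * n]}]_n :=
  \matrix_(i, j) 'X_(rshift _ (mxvec_index i j)).

Lemma meval_coordA (A B : 'M[F]_n) :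
  map_mx (meval (mx_pair_coords (A, B) 0)) coordA = A.
Proof. by apply/matrixP => i j; rewrite !mxE mevalXU row_mxEl mxvecE. Qed.

Lemma meval_coordB (A B : 'M[F]_n) :
  map_mx (meval (mx_pair_coords (A, B) 0)) coordB = B.
Proof. by apply/matrixP => i j; rewrite !mxE mevalXU row_mxEr mxvecE. Qed.

Lemma pair_coords_surj (v : 'rV[F]_(n * n + n * n)) :
  exists A B : 'M[F]_n, v = mx_pair_coords (A, B).
Proof.
exists (vec_mx (lsubmx v)), (vec_mx (rsubmx v)).
by rewrite /mx_pair_coords /= !vec_mxK hsubmxK.
Qed.

Lemma zariski_closure_sub_U (Y : set 'rV[F]_(n * n + n * n)) :
    (forall v, Y v -> exists2 AB : 'M[F]_n * 'M[F]_n, v = mx_pair_coords AB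
       & U AB /\ AB.2 ^+ n = 0) ->
  zariski_closure Y `<=` image (@U F n) (@mx_pair_coords F n).
Proof.
move=> YU v; have [A [B ->]] := pair_coords_surj v => Y_AB.
have mx0 (M : 'M[{mpoly F[n * n + n * n]}]_n) :
    (forall v, Y v -> map_mx (meval (v 0)) M = 0) ->
    map_mx (meval (mx_pair_coords (A, B) 0)) M = 0.
  move=> YM; apply/matrixP => i j; rewrite [LHS]mxE mxE; apply: Y_AB => w /YM.
  by move/matrixP/(_ i j); rewrite [LHS]mxE mxE.
exists (A, B) => //; split.
  exists n; have := mx0 (coordB ^+ n).
  rewrite rmorphXn /= meval_coordB; apply=> w /YU[[A' B'] -> [_ /= B'n]].
  by rewrite rmorphXn /= meval_coordB.
have evE A' B' : map_mx (meval (mx_pair_coords (A', B') 0))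
    (coordA ^+ 2 - (coordA * coordB) *+ 2 + coordB ^+ 2) =
    A' ^+ 2 - (A' * B') *+ 2 + B' ^+ 2.
  rewrite rmorphD rmorphB rmorphMn !rmorphXn rmorphM /=.
  by rewrite meval_coordA meval_coordB.
by rewrite -[LHS]evE; apply: mx0 => w /YU[[A' B'] -> [[_ /= AB'] _]]; rewrite evE.
Qed.

End CoordinateMatrices.

Lemma conj_mx_exp (F : fieldType) n (g X : 'M[F]_n) k :
  g \in unitmx -> conj_mx g (X ^+ k) = conj_mx g X ^+ k.
Proof.
move=> gu; elim: k => [|k IH].
  by rewrite !expr0 /conj_mx -[1]/(1%:M) mulmx1 mulVmx.
by rewrite !exprS -IH -[X * _]/(X *m _) conj_mx_mul.
Qed.

Section FamilyChain.
Variables (F : closedFieldType) (n' : nat).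
Let n := n'.+1.
Implicit Types (t : family_index n' -> F) (D : set (family_index n')).

Definition family_point t : 'rV[F]_(n * n + n * n) :=
  conj_point (family_g t) (jordan_block n' F) (family_N t).

(** The power [n] in place of an unspecified one makes the condition closed. *)
Lemma family_point_in_U t : family_g t \in unitmx ->
  exists2 AB : 'M[F]_n * 'M[F]_n, family_point t = mx_pair_coords AB
    & U AB /\ AB.2 ^+ n = 0.
Proof.
move=> gu; set X := conj_mx (family_g t) (jordan_block n' F).
set B := conj_mx (family_g t) (family_N t).
have Bn : B ^+ n = 0.
  by rewrite -conj_mx_exp // family_N_nilpotent /conj_mx mulmx0 mul0mx.
exists (X + B, B) => //; split=> //; split; first by exists n.
rewrite [LHS]pair_equationE -[X * B]/(X *m B) -[B * X]/(B *m X) -[X * X]/(X *m X).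
rewrite -!conj_mx_mul // -conj_mxB -[_ *m family_N t]/(_ * _).
by rewrite -[family_N t *m _]/(_ * _) family_commutator subrr.
Qed.

(** On the family, [g] is read off from the powers of [X = g^-1 J g]: its [i]-th
    row is [e_0 X^i], because [e_0 g = e_0]. *)
Lemma family_krylov t (i j : 'I_n) : family_g t \in unitmx ->
  (conj_mx (family_g t) (jordan_block n' F) ^+ i) ord0 j = family_g t i j.
Proof.
move=> gu; set X := conj_mx _ _; set g := family_g t.
have gX k : g *m X ^+ k = jordan_block n' F ^+ k *m g.
  by rewrite -conj_mx_exp // /conj_mx -mulmxA mulKVmx.
have rowE0 : row ord0 (jordan_block n' F ^+ i) = delta_mx 0 i.
  by apply/rowP => a; rewrite !mxE jordanX_row0 // eqxx.
have /rowP/(_ j) : row ord0 (X ^+ i) = row i g.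
  by rewrite rowE -(family_g_row0 t) -row_mul gX row_mul rowE0 -rowE.
by rewrite !mxE.
Qed.

(** Similarly [e_0 B = e_0 N g] recovers the first row of [N], up to the
    determinant of [g]. *)
Definition family_coordinate (x : family_index n') : {mpoly F[n * n + n * n]} :=
  let X := coordA F n - coordB F n in
  match x with
  | inl (i, j) => (X ^+ i.+1) ord0 j - (lift ord0 i == j)%:R
  | inr l => (coordB F n *m \adj (\matrix_(i, j) (X ^+ i) ord0 j)) ord0 (lift ord0 l)
  end.

Lemma family_coordinateE t x : family_g t \in unitmx ->
  exists2 e, e != 0 & (family_coordinate x).@[family_point t 0] = e * t x.
Proof.
move=> gu; set X := conj_mx (family_g t) (jordan_block n' F).
set B := conj_mx (family_g t) (family_N t).
pose ev : {rmorphism {mpoly F[n * n + n * n]} -> F} := meval (family_point t 0).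
have evB : map_mx ev (coordB F n) = B by apply: meval_coordB.
have evX : map_mx ev (coordA F n - coordB F n) = X.
  by rewrite map_mxB /= evB [map_mx _ _]meval_coordA addrK.
have evXk k i j : ev (((coordA F n - coordB F n) ^+ k) i j) = (X ^+ k) i j.
  by rewrite -evX -(rmorphXn (map_mx ev)) [RHS]mxE.
rewrite -/(ev _); case: x => [[i j]|l].
  exists 1; first exact: oner_neq0.
  rewrite rmorphB rmorph_nat evXk (family_krylov (lift ord0 i)) //.
  by rewrite mxE liftK addrAC subrr add0r mul1r.
exists (\det (family_g t)); first by rewrite -unitfE -unitmxE.
have mapE (M : 'M[{mpoly F[n * n + n * n]}]_n) i j : ev (M i j) = map_mx ev M i j.
  by rewrite mxE.
rewrite /family_coordinate mapE map_mxM evB map_mx_adj.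
have -> : map_mx ev (\matrix_(i, j) ((coordA F n - coordB F n) ^+ i) ord0 j)
    = family_g t.
  by apply/matrixP => i j; rewrite mxE mxE evXk family_krylov.
have gB : row ord0 B = row ord0 (family_N t *m family_g t).
  rewrite [LHS]rowE -(family_g_row0 t) -row_mul /B /conj_mx.
  by rewrite -(mulmxA (invmx _)) mulKVmx.
have -> : (B *m \adj (family_g t)) ord0 (lift ord0 l) =
    (row ord0 B *m \adj (family_g t)) 0 (lift ord0 l).
  by rewrite -row_mul [RHS]mxE.
rewrite gB -row_mul -mulmxA mul_mx_adj mul_mx_scalar [LHS]mxE mxE.
by rewrite family_N_row0.
Qed.

Definition family_slice D : set 'rV[F]_(n * n + n * n) :=
  [set v | exists t, [/\ forall x, ~ D x -> t x = 0, family_g t \in unitmx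
                       & v = family_point t]].

Let ev x : {rmorphism {poly F} -> F} := horner_eval x.

Let line t u (i : family_index n') : {poly F} := (t i)%:P + 'X * (u i - t i)%:P.

Lemma regular_line t u (p : {mpoly F[n * n + n * n]}) :
  regular ev (\det (family_g (line t u)))
    (fun x => p.@[family_point (ev x \o line t u) 0]).
Proof.
have evC x c : ev x c%:P = c by apply: hornerC.
have := regular_conj_point (family_g (line t u)) (jordan_block n' _)
  (family_N (line t u)) p evC.
apply: eq_regular => x _.
by rewrite map_family_g map_jordan_block map_family_N.
Qed.

(** If [p] is not zero at one parameter and [q] at another, then on the line
    joining them [p], [q] and the determinant of [g] are nonzero rational
    functions of one variable, and so is their product. *)
Lemma family_slice_irreducible D :
  irreducible_closed (zariski_closure (family_slice D)).
Proof.
apply: irreducible_zariski_closure.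
  exists (family_point (fun=> 0)), (fun=> 0); split=> //.
  have -> : family_g (fun=> 0) = 1%:M :> 'M[F]_n; last exact: unitmx1.
  by apply/matrixP => i j; rewrite !mxE; case: unliftP => *; rewrite addr0.
move=> p q pq0; apply: contrapT => /not_orP[].
move=> /existsNP[_ /not_implyP[[t [Dt gt ->]] pt]].
move=> /existsNP[_ /not_implyP[[u [Du gu ->]] qu]].
have [N [p1 p1E]] := regular_line t u p; have [M [q1 q1E]] := regular_line t u q.
pose d := \det (family_g (line t u)).
have detE x : ev x d = \det (family_g (ev x \o line t u)).
  by rewrite -det_map_mx map_family_g.
have line0 : ev 0 \o line t u = t.
  apply/funext => i; rewrite /= horner_evalE.
  by rewrite hornerD hornerM hornerX !hornerC mul0r addr0.
have line1 : ev 1 \o line t u = u.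
  apply/funext => i; rewrite /= horner_evalE.
  by rewrite hornerD hornerM hornerX !hornerC mul1r addrC subrK.
have dt : ev 0 d != 0 by rewrite detE line0 -unitfE -unitmxE.
have du : ev 1 d != 0 by rewrite detE line1 -unitfE -unitmxE.
have p10 : p1 != 0.
  apply/eqP => p10; move: (p1E 0 dt); rewrite p10 rmorph0 line0 => /eqP.
  by rewrite mulf_eq0 expf_eq0 (negPf dt) andbF orbF => /eqP.
have q10 : q1 != 0.
  apply/eqP => q10; move: (q1E 1 du); rewrite q10 rmorph0 line1 => /eqP.
  by rewrite mulf_eq0 expf_eq0 (negPf du) andbF orbF => /eqP.
have d0 : d != 0 by apply: contraNneq dt => ->; rewrite rmorph0.
have /closed_nonrootP[x] : p1 * q1 * d != 0 by rewrite !mulf_neq0.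
rewrite rootE !hornerM !mulf_eq0 !negb_or -!horner_evalE -andbA.
move=> /and3P[px qx dx]; have gx : family_g (ev x \o line t u) \in unitmx.
  by rewrite unitmxE unitfE -detE.
have /eqP : p.@[family_point (ev x \o line t u) 0] *
    q.@[family_point (ev x \o line t u) 0] = 0.
  apply: pq0.
  exists (ev x \o line t u); split=> // i nDi.
  by rewrite /line /= Dt // Du // subrr polyC0 mulr0 addr0 rmorph0.
rewrite mulf_eq0 => /orP[] /eqP pq.
  by move: px; rewrite -[horner_eval x p1]/(ev x p1) -p1E // pq mul0r eqxx.
by move: qx; rewrite -[horner_eval x q1]/(ev x q1) -q1E // pq mul0r eqxx.
Qed.

(** Each step of the chain frees one parameter [x]; the polynomial recovering [x]
    vanishes before the step and not after it. *)
Lemma family_chain :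
  exists C, irreducible_chain (image (@U F n) (@mx_pair_coords F n)) (n ^ 2 - 1) C.
Proof.
pose D i : set (family_index n') := [set x | (enum_rank x < i)%N].
exists (fun i => zariski_closure (family_slice (D i))); split=> [i _|i|].
- exact: family_slice_irreducible.
- rewrite -card_family_index => ltiI.
  have subD : family_slice (D i) `<=` family_slice (D i.+1).
    move=> v [t [Dt gt ->]]; exists t; split=> // x nDx; apply: Dt.
    by apply: contra_not nDx => /ltnW.
  split.
    apply: zariski_closure_min; first exact: zariski_closure_closed.
    exact: subset_trans subD (@sub_zariski_closure _ _ _).
  pose x := enum_val (Ordinal ltiI).
  have xi : enum_rank x = i :> nat by rewrite enum_valK.
  have h0 : vanishing_ideal (family_slice (D i)) (family_coordinate x).
    move=> _ [t [Dt gt ->]]; have [e _ ->] := family_coordinateE x gt.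
    by rewrite Dt ?mulr0 // /D /= xi ltnn.
  (* The parameter [x] is the variable, the other parameters are zero; at 0 this
     gives [g = 1]. *)
  pose tP (y : family_index n') : {poly F} := if y == x then 'X else 0.
  have dE c : ev c (\det (family_g tP)) = \det (family_g (ev c \o tP)).
    by rewrite -det_map_mx map_family_g.
  have d0 : \det (family_g tP) != 0.
    apply: contraTneq (oner_neq0 F) => d0; have := dE 0; rewrite d0 rmorph0.
    have -> : ev 0 \o tP = fun=> 0.
      apply/funext => y; rewrite /= /tP; case: ifP => _; last by rewrite rmorph0.
      by rewrite horner_evalE hornerX.
    have -> : family_g (fun=> 0) = 1%:M :> 'M[F]_n.
      by apply/matrixP => a b; rewrite !mxE; case: unliftP => *; rewrite addr0.
    by rewrite det1 => <-; rewrite eqxx.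
  have /closed_nonrootP[c] : 'X * \det (family_g tP) != 0.
    by rewrite mulf_neq0 ?polyX_eq0.
  rewrite rootE hornerM hornerX mulf_eq0 negb_or => /andP[c0].
  rewrite -horner_evalE -/(ev c _) dE -unitfE -unitmxE => gu.
  move=> /(_ (family_point (ev c \o tP))) sub.
  have /sub/(_ _ h0) : zariski_closure (family_slice (D i.+1))
      (family_point (ev c \o tP)).
    apply: sub_zariski_closure; exists (ev c \o tP); split=> // y nDy.
    rewrite /= /tP; case: eqP => [yx|_]; last by rewrite rmorph0.
    by case: nDy; rewrite yx /D /= xi.
  have [e e0 ->] := family_coordinateE x gu.
  rewrite /= /tP eqxx horner_evalE hornerX => /eqP.
  by rewrite mulf_eq0 (negPf e0) (negPf c0).
apply: zariski_closure_sub_U => _ [t [_ gt ->]].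
exact: family_point_in_U.
Qed.

End FamilyChain.

(** * Dimension *)

Lemma irreducible_chain_sub (F : fieldType) m (X Z : set 'rV[F]_m) e C :
  Z `<=` X -> irreducible_chain Z e C -> irreducible_chain X e C.
Proof. by move=> ZX [irrC ltC CZ]; split=> // v /CZ/ZX. Qed.

(** When the length of the chains is bounded, the top of a chain of the maximal
    length is a component, as a larger irreducible set would extend the chain. *)
Lemma algebraic_set_dim_of_chains (F : fieldType) m (X : set 'rV[F]_m) d :
    (exists C, irreducible_chain X d C) ->
    (forall e C, irreducible_chain X e C -> (e <= d)%N) ->
  algebraic_set_dim X d.
Proof.
move=> [C chC] leXd; have [irrC ltC CX] := chC; split.
  exists (C d); last first.
    split; first by exists C; split.
    by move=> e C' /(irreducible_chain_sub CX)/leXd.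
  split=> //; first exact: irrC.
  move=> Z irrZ ZX CZ; apply/seteqP; split=> //; apply: contrapT => nZC.
  suff /leXd : irreducible_chain X d.+1 (fun i => if (i <= d)%N then C i else Z).
    by rewrite ltnn.
  split=> [i _|i id|]; last by rewrite ltnn.
    by case: ifP => // /irrC.
  rewrite -ltnS id; move: id; rewrite ltnS leq_eqVlt => /orP[/eqP->|id].
    by rewrite ltnn.
  by rewrite id; apply: ltC.
move=> Z [irrZ ZX _].
have leZd e C' : irreducible_chain Z e C' -> (e <= d)%N.
  by move/(irreducible_chain_sub ZX)/leXd.
have exZ : exists e, `[< exists C', irreducible_chain Z e C' >].
  by exists 0%N; apply/asboolP; exists (fun=> Z); split.
have bZ e : `[< exists C', irreducible_chain Z e C' >] -> (e <= d)%N.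
  by move/asboolP => [C' /leZd].
case: (ex_maxnP exZ bZ) => e /asboolP chZ maxe; exists e; last first.
  by apply: bZ; apply/asboolP.
by split=> // e' C' chC'; apply: maxe; apply/asboolP; exists C'.
Qed.

Lemma natr_neq0_closure (n : nat) (K L : fieldType) (iota : {rmorphism K -> L}) k :
    [pchar K]%R =i pred0 \/ (exists2 p : nat, p \in [pchar K]%R & (n < p)%N) ->
  (0 < k <= n)%N -> k%:R != 0 :> L.
Proof.
move=> charK /andP[k0 kn]; rewrite -(rmorph_nat iota) fmorph_eq0.
apply/negP => kK; case: charK => [charK0|[p pK np]].
  by have [p] := natf0_pchar k0 kK; rewrite charK0.
move: kK; rewrite -(dvdn_pcharf pK) => /(dvdn_leq k0) pk.
by have := leq_trans np (leq_trans pk kn); rewrite ltnn.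
Qed.

Theorem proposition5 (n : nat) (K : fieldType) (L : closedFieldType)
    (iota : {rmorphism K -> L})
    (hn : (2 <= n)%N)
    (hchar : [pchar K]%R =i pred0 \/ (exists2 p : nat, p \in [pchar K]%R & (n < p)%N))
    (hL : is_algebraic_closure iota) :
  algebraic_set_dim (image (@U L n) (@mx_pair_coords L n)) (n ^ 2 - 1)%N.
Proof.
have n0 : (0 < n)%N := ltnW hn.
have charL k := natr_neq0_closure iota (k := k) hchar.
apply: algebraic_set_dim_of_chains.
  by case: (n) n0 => // n' _; apply: family_chain.
move=> e C chC; rewrite leqNgt; apply/negP => lt_e.
have le_e : (n ^ 2 <= e)%N by move: lt_e; rewrite subn1 prednK ?expn_gt0 ?n0.
have [f indf] := irreducible_chain_independent chC (leqnn e).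
have [P P0 PE] := U_dependent f n0 charL le_e.
case/eqP: P0; apply: indf => v; have [_ _ CU] := chC.
by move=> /CU[[A B] UAB <-]; apply: PE.
Qed.
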